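(* The magnitude map $\mathrm{mag}\colon \mathrm{Cmp}_+(\mathbb{R})\to\mathbb{R}$ is continuous, and its restrictions to bounded subspaces are Lipschitz, i.e. for every bounded subset $B\subseteq\mathbb{R}$ the restriction $\mathrm{mag}\colon \mathrm{Cmp}_+(B)\to\mathbb{R}$ is Lipschitz.
   Context: $\mathbb{R}$ carries its usual metric. For a finite set $F=\{a_1,\dots,a_n\}\subseteq\mathbb{R}$ (distinct points), its similarity matrix $Z_F$ with entries $(Z_F)_{ij}=e^{-|a_i-a_j|}$ is positive definite, and its magnitude $\mathrm{mag}(F)$ is the sum of all entries of $Z_F^{-1}$ (so $\mathrm{mag}(\emptyset)=0$). For a compact $K\subseteq\mathbb{R}$, $\mathrm{mag}(K):=\sup\{\mathrm{mag}(F):F\subseteq K\text{ finite}\}$, which is finite and agrees with the previous definition when $K$ is finite. $\mathrm{Cmp}_+(A)$ denotes the set of non-empty compact subsets of $A$, equipped with the Hausdorff metric $d_H$. *)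

(* Defs.v *)
From HB Require Import structures.
From mathcomp Require Import all_boot all_order all_algebra finmap.
From mathcomp Require Import all_classical all_reals all_analysis.

Set Implicit Arguments.
Unset Strict Implicit.
Unset Printing Implicit Defensive.

Import Order.TTheory GRing.Theory Num.Theory.
Import numFieldNormedType.Exports.

Local Open Scope classical_set_scope.
Local Open Scope ring_scope.

(* The points of F are listed, without repetition, by [enum_fset F]; the
   magnitude below does not depend on this choice of order. *)
Definition similarity_mx (R : realType) (F : {fset R}) : 'M[R]_(#|` F|) :=
  \matrix_(i, j) expR (- `|(enum_fset F)`_i - (enum_fset F)`_j|).

Definition fmag (R : realType) (F : {fset R}) : R :=
  \sum_i \sum_j (invmx (similarity_mx F)) i j.

(* The set of values is bounded above when K is compact, so [sup] does not
   take its default value there. *)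
Definition mag (R : realType) (K : set R) : R :=
  sup [set fmag F | F in [set F : {fset R} | [set` F] `<=` K]].

Definition dist_to (R : realType) (A : set R) (x : R) : R :=
  inf [set `|x - a| | a in A].

Definition hausdorff_excess (R : realType) (A B : set R) : R :=
  sup [set dist_to B x | x in A].

Definition hausdorff_dist (R : realType) (A B : set R) : R :=
  Num.max (hausdorff_excess A B) (hausdorff_excess B A).

Record Cmp (R : realType) (A : set R) := MkCmp {
  cmp_set :> set R ;
  cmp_compact : compact cmp_set ;
  cmp_neq0 : cmp_set !=set0 ;
  cmp_sub : cmp_set `<=` A }.

Lemma cmp_inj (R : realType) (A : set R) (K L : Cmp A) :
  K = L :> set R -> K = L.
Proof.
case: K => K cK nK sK; case: L => L cL nL sL /= KL.
move: cL nL sL; rewrite -KL => cL nL sL.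
by rewrite (Prop_irrelevance cK cL) (Prop_irrelevance nK nL)
           (Prop_irrelevance sK sL).
Qed.

Section hausdorff_lemmas.
Context {R : realType}.
Implicit Types (A B C : set R) (x y a : R).

Lemma dist_to_has_inf A x : A !=set0 -> has_inf [set `|x - a| | a in A].
Proof.
move=> [a Aa]; split; first by exists `|x - a|, a.
by exists 0 => _ [b _ <-].
Qed.

Lemma dist_to_le A x a : A a -> dist_to A x <= `|x - a|.
Proof.
by move=> Aa; apply: ge_inf; [exists 0 => _ [b _ <-]|exists a].
Qed.

Lemma le_dist_to A x (c : R) : A !=set0 ->
  (forall a, A a -> c <= `|x - a|) -> c <= dist_to A x.
Proof.
move=> [a Aa] cA; apply: lb_le_inf; first by exists `|x - a|, a.
by move=> _ [b Ab <-]; exact: cA.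
Qed.

Lemma dist_to_ge0 A x : A !=set0 -> 0 <= dist_to A x.
Proof. by move=> A0; exact: le_dist_to. Qed.

Lemma dist_to_triangle A x y : A !=set0 ->
  dist_to A x <= `|x - y| + dist_to A y.
Proof.
move=> A0; rewrite -lerBlDl; apply: le_dist_to => // a Aa.
by rewrite lerBlDl (le_trans (dist_to_le _ Aa))// ler_distD.
Qed.

Lemma dist_to_excess A B x : compact A -> B !=set0 -> A x ->
  dist_to B x <= hausdorff_excess A B.
Proof.
move=> cA [b Bb] Ax; apply: ub_le_sup; last by exists x.
have [M [_ MA]] := compact_bounded cA.
exists (M + 1 + `|b|) => _ [a Aa <-].
rewrite (le_trans (dist_to_le _ Bb))// (le_trans (ler_normB _ _))// lerD2r.
by apply: MA => //; rewrite ltrDl.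
Qed.

Lemma excess_le A B (c : R) : A !=set0 ->
  (forall x, A x -> dist_to B x <= c) -> hausdorff_excess A B <= c.
Proof.
move=> [a Aa] Ac; apply: ge_sup; first by exists (dist_to B a), a.
by move=> _ [x Ax <-]; exact: Ac.
Qed.

Lemma excess_triangle A B C : compact A -> compact B ->
  A !=set0 -> B !=set0 -> C !=set0 ->
  hausdorff_excess A C <= hausdorff_excess A B + hausdorff_excess B C.
Proof.
move=> cA cB A0 B0 C0; apply: excess_le => // x Ax.
apply: (@le_trans _ _ (dist_to B x + hausdorff_excess B C)); last first.
  by rewrite lerD2r dist_to_excess.
rewrite -lerBlDr; apply: le_dist_to => // b Bb.
rewrite lerBlDr (le_trans (dist_to_triangle x b C0))// lerD2l.
exact: dist_to_excess.
Qed.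

Lemma excess_le0 A B : compact A -> compact B -> B !=set0 ->
  hausdorff_excess A B <= 0 -> A `<=` B.
Proof.
move=> cA cB B0 AB x Ax.
have clB : closed B by apply: compact_closed => //; exact: Rhausdorff.
apply: clB => U /nbhs_ballP[e /= e0 eU].
have /(inf_adherent e0) : has_inf [set `|x - b| | b in B].
  exact: dist_to_has_inf.
case=> _ [b Bb <-] xb; exists b; split => //; apply: eU.
rewrite /ball/=; apply: (lt_le_trans xb); rewrite gerDr.
exact: le_trans (dist_to_excess cA B0 Ax) AB.
Qed.

End hausdorff_lemmas.

Section cmp_metric.
Context {R : realType} {A : set R}.
Implicit Types K L M : Cmp A.

Let dH K L : R := hausdorff_dist K L.

Let dHxx K : dH K K = 0.
Proof.
rewrite /dH /hausdorff_dist maxxx; apply/eqP; rewrite eq_le; apply/andP; split.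
  apply: excess_le => [|x Kx]; first exact: cmp_neq0.
  by rewrite (le_trans (dist_to_le _ Kx))// subrr normr0.
have [x Kx] := cmp_neq0 K.
apply: le_trans (dist_to_excess (@cmp_compact _ _ K) (cmp_neq0 K) Kx).
exact/dist_to_ge0/cmp_neq0.
Qed.

Let dH_positivity K L : dH K L = 0 -> K = L.
Proof.
move=> KL0; have : dH K L <= 0 by rewrite KL0.
rewrite /dH /hausdorff_dist ge_max => /andP[KL LK].
apply: cmp_inj; apply/seteqP; split.
- by apply: excess_le0 KL; [exact: cmp_compact..|exact: cmp_neq0].
- by apply: excess_le0 LK; [exact: cmp_compact..|exact: cmp_neq0].
Qed.

Let dH_sym K L : dH K L = dH L K.
Proof. by rewrite /dH /hausdorff_dist maxC. Qed.

Let dH_triangle L K M : dH K M <= dH K L + dH L M.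
Proof.
have cmpP (N : Cmp A) : compact N /\ N !=set0.
  by split; [exact: cmp_compact|exact: cmp_neq0].
have [cK K0] := cmpP K; have [cL L0] := cmpP L; have [cM M0] := cmpP M.
rewrite {1}/dH /hausdorff_dist ge_max; apply/andP; split.
- rewrite (le_trans (excess_triangle cK cL K0 L0 M0))//.
  by rewrite lerD// /dH /hausdorff_dist le_max lexx.
- rewrite (le_trans (excess_triangle cM cL M0 L0 K0))// addrC.
  by rewrite lerD// /dH /hausdorff_dist le_max lexx orbT.
Qed.

HB.instance Definition _ := gen_eqMixin (Cmp A).
HB.instance Definition _ := gen_choiceMixin (Cmp A).
HB.instance Definition _ := @isMetric.Build R (Cmp A)
  dH dHxx dH_positivity dH_sym dH_triangle.

End cmp_metric.

Lemma mdist_CmpE (R : realType) (A : set R) (K L : Cmp A) :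
  mdist K L = hausdorff_dist K L.
Proof. by []. Qed.

(* Main.v *)
Require Import Defs.
From mathcomp Require Import all_boot all_order all_algebra finmap ring lra.
From mathcomp Require Import all_classical all_reals all_analysis.
Import Order.TTheory GRing.Theory Num.Theory.
Import numFieldNormedType.Exports.
Local Open Scope classical_set_scope.
Local Open Scope ring_scope.

(** The idea is that the magnitude of a finite set of points
    [x_1 < ... < x_n] of the line is [1 + \sum_i g (x_(i+1) - x_i)] with
    [g t = tanh (t / 2)] (lemma [fmag_line]).  It is proved by solving the
    linear systems of the similarity matrix explicitly: passing from
    [x_2, ..., x_n] to [x_1, ..., x_n] changes the solution only at [x_1] and
    [x_2], since a point to the left of [x_2] sees the other points through
    [x_2], multiplicatively.

    Moving each point by at most [d] changes the sum of the gaps by at most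
    [2 d], but a termwise estimate of the sum of the [g]'s would cost
    a multiple of [d] for each of the [n] points, and [n] is unbounded.  What
    saves the argument is that [g t] is [t / 2] up to a term with vanishing
    derivative at 0.  The linear parts telescope to half of the difference of
    the diameters, which costs [d] in total.  For a gap that becomes
    a gap of length [t], the rest costs at most [2 d t] (lemma
    [tanh_half_step]), which sums up to [2 d] times the diameter, whatever the
    number of points.

    If every point of [K] has a point of [L] at distance at most [d], then
    each finite subset of [K] is followed by a finite subset of [L] in the same
    order (lemma [line_follow]), so that [mag K <= mag L + C d], where [C]
    only depends on a bound of [L].  Exchanging [K] and [L] gives the Lipschitz
    estimate on bounded sets.  Continuity is local, and a Hausdorff ball
    around a compact set lies in a bounded set. *)

(** * The function tanh (t / 2) *)

(** This is [tanh (t / 2)], expressed by the entry [expR (- t)] of the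
    similarity matrix of two points at distance [t]. *)
Definition tanh_half {R : realType} (t : R) : R :=
  (1 - expR (- t)) / (1 + expR (- t)).

Section tanh_half.
Context {R : realType}.
Implicit Types s t d : R.

Lemma tanh_half0 : tanh_half (0 : R) = 0.
Proof. by rewrite /tanh_half oppr0 expR0 subrr mul0r. Qed.

Lemma tanh_half_ge0 t : 0 <= t -> 0 <= tanh_half t.
Proof.
move=> t0; apply: divr_ge0; last by rewrite addr_ge0 ?expR_ge0.
by rewrite subr_ge0 -[leRHS]expR0 ler_expR oppr_le0.
Qed.

Lemma tanh_half_le1 t : tanh_half t <= 1.
Proof.
rewrite /tanh_half ler_pdivrMr ?addr_gt0 ?expR_gt0//.
by have := expR_ge0 (- t); lra.
Qed.

(** After clearing denominators, the derivative of the difference of the two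
    sides is [1 - (1 + t) e^-t], which is nonnegative as [1 + t <= e^t].  The
    constant [1 / 2] has to be sharp: it is the coefficient of the part of the
    magnitude that telescopes. *)
Lemma tanh_half_le t : 0 <= t -> tanh_half t <= t / 2.
Proof.
rewrite le_eqVlt => /predU1P[<-|t0]; first by rewrite tanh_half0 mul0r.
pose f (x : R) := x * (1 + expR (- x)) - 2 * (1 - expR (- x)).
pose df (x : R) : R := 1 - (1 + x) * expR (- x).
have dfE (x : R) : is_derive x 1 f (df x).
  apply: is_derive_eq; rewrite /df /GRing.scale/= expRN.
  ring.
have [|c _ fE] := @MVT R f df 0 t t0 (fun x _ => dfE x).
  apply: derivable_within_continuous => x _.
  by have [dx _] := dfE x.
have : 0 <= f t.
  have -> : f t = df c * t.
    have f0 : f 0 = 0 by rewrite /f oppr0 expR0 mul0r subrr mulr0 subr0.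
    by move: fE; rewrite f0 !subr0.
  rewrite mulr_ge0 ?(ltW t0)// subr_ge0 expRN ler_pdivrMr ?expR_gt0// mul1r.
  exact: expR_ge1Dx.
rewrite /tanh_half ler_pdivrMr ?addr_gt0 ?expR_gt0// /f; lra.
Qed.

Lemma tanh_half_ge t : 0 <= t -> t / 2 - t ^+ 2 / 2 <= tanh_half t.
Proof.
move=> t0; have t1 : 0 < 1 + t by lra.
set v := expR (- t).
have v0 : 0 < v by exact: expR_gt0.
have v1 : v <= 1 by rewrite -[leRHS]expR0 ler_expR oppr_le0.
have vt : v * (1 + t) <= 1.
  by rewrite /v expRN mulrC ler_pdivrMr ?expR_gt0// mul1r expR_ge1Dx.
apply: (@le_trans _ _ ((1 - v) / 2)); last first.
  by rewrite /tanh_half -/v ler_pdivlMr; nra.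
rewrite -(ler_pM2r t1); nra.
Qed.

(** The subtraction formula of the hyperbolic tangent. *)
Lemma tanh_halfB s t : tanh_half (t + s) - tanh_half t =
  tanh_half s * (1 - tanh_half t * tanh_half (t + s)).
Proof.
rewrite /tanh_half opprD expRD.
have := expR_gt0 (- s); have := expR_gt0 (- t).
set u := expR (- t); set v := expR (- s) => u0 v0.
have uv : 0 < u * v by exact: mulr_gt0.
field.
by apply/and3P; split; apply: lt0r_neq0; lra.
Qed.

(** The key estimate: what [tanh_half] loses when a gap [s] is replaced by
    a gap [t] exceeds half of the change of the gap by an error proportional to
    the length [t], not just to [d].  If [t <= s] there is no error since [tanh_half] has slope at
    most [1 / 2].  If [s <= t], the subtraction formula bounds the increase
    below by [(t - s) / 2 - (t - s) ^+ 2 / 2 - (t - s) t / 4], and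
    [t - s <= min t (2 d)]. *)
Lemma tanh_half_step d s t : 0 <= d -> 0 <= s -> 0 <= t -> t <= s + 2 * d ->
  tanh_half s <= tanh_half t + (s - t) / 2 + 2 * d * t.
Proof.
move=> d0 s0 t0 tsd.
have [ts|/ltW st] := leP t s.
  have g0 : 0 <= tanh_half t * tanh_half s by rewrite mulr_ge0 ?tanh_half_ge0.
  have := tanh_halfB (s - t) t; rewrite subrKC.
  have st0 : 0 <= s - t by rewrite subr_ge0.
  have := tanh_half_le _ st0; have := tanh_half_ge0 _ st0.
  have := mulr_ge0 d0 t0.
  nra.
have ts0 : 0 <= t - s by rewrite subr_ge0.
have := tanh_halfB (t - s) s; rewrite subrKC.
have := tanh_half_ge _ ts0; have := tanh_half_le _ ts0.
have := tanh_half_ge0 _ ts0; have := tanh_half_ge0 _ s0.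
have := tanh_half_ge0 _ t0; have := tanh_half_le1 s; have := tanh_half_le _ t0.
set a := tanh_half s; set b := tanh_half t; set c := tanh_half (t - s).
move=> bt a1 b0 a0 c0 c1 c2 bac.
have ab : a * b <= t / 2 by nra.
have cab : c * (a * b) <= (t - s) / 2 * (t / 2).
  by apply: ler_pM => //; exact: mulr_ge0.
have sq : (t - s) ^+ 2 <= (t - s) * t by nra.
have dt : (t - s) * t <= 2 * d * t by rewrite ler_wpM2r ?lerBlDl.
nra.
Qed.
End tanh_half.

(** * The magnitude of a finite set of points of the line *)

(** Repetitions in a nondecreasing list are harmless, as a gap of length 0
    contributes 0; [line_follow] does produce such lists. *)
Fixpoint line_mag {R : realType} (x : R) (s : seq R) : R :=
  if s is y :: s' then tanh_half (y - x) + line_mag y s' else 1.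

Section formula.
Context {R : realType}.
Implicit Types (x : R) (s : seq R) (f : R -> R).

Lemma sum_addpoint (h c : R -> R) y (a : R) (U : seq R) : uniq U -> y \in U ->
  \sum_(u <- U) (c u + (u == y)%:R * a) * h u =
  \sum_(u <- U) c u * h u + a * h y.
Proof.
move=> uU yU.
under eq_bigr do rewrite mulrDl.
rewrite big_split/=; congr (_ + _).
rewrite (bigD1_seq y)//= eqxx mul1r big1 ?addr0// => u /negPf ->.
by rewrite !mul0r.
Qed.

(** Solvability of the linear system of the similarity matrix for every
    right-hand side [f], by induction from the right.  When [x] is added to the
    left of [y], put a weight [w] at [x] and compensate it by [- w q] at [y],
    where [q = e^-(y - x)]: this leaves the potential unchanged at [y] and to
    its right.  The old weights produce [q f(y)] at [x], so that [w] is found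
    from [w (1 - q^2) = f(x) - q f(y)], and the total weight grows by
    [w (1 - q)], that is [tanh_half (y - x)] for [f = 1]. *)
Lemma line_interpolation f s x : path <=%R x s -> exists c : R -> R,
  (forall z, z \in x :: s ->
    \sum_(y <- undup (x :: s)) c y * expR (- `|z - y|) = f z) /\
  ((forall z, f z = 1) -> \sum_(y <- undup (x :: s)) c y = line_mag x s).
Proof.
elim: s x => [|y s ih] x /=.
  move=> _; exists (fun=> f x); split => [z|f1]; last by rewrite big_seq1.
  by rewrite inE => /eqP ->; rewrite big_seq1 subrr normr0 oppr0 expR0 mulr1.
case/andP => xy pys; have [c [cf c1]] := ih _ pys.
case: (eqVneq x y) xy pys cf c1 => [<-{y}|xNy] xy pys cf c1.
  exists c; rewrite mem_head; split=> [z|f1].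
    by rewrite inE => /predU1P[->|]; apply: cf; rewrite ?mem_head.
  by rewrite subrr tanh_half0 add0r -c1.
have ltxy : x < y by rewrite lt_neqAle xNy.
have ys_ge z : z \in y :: s -> y <= z.
  rewrite inE => /predU1P[->//|].
  exact: (allP (order_path_min le_trans pys)).
have /negPf xNys : x \notin y :: s.
  by apply: contraL ltxy => /ys_ge; rewrite leNgt.
rewrite xNys.
set q := expR (- (y - x)).
have q0 : 0 < q by exact: expR_gt0.
have q1 : q < 1 by rewrite -[ltRHS]expR0 ltr_expR oppr_lt0 subr_gt0.
pose w := (f x - q * f y) / (1 - q ^+ 2).
have wE : w * (1 - q ^+ 2) = f x - q * f y by rewrite /w divfK//; nra.
pose c' u := if u == x then w else c u + (u == y)%:R * (- (w * q)).
set U := undup (y :: s).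
have uU : uniq U by exact: undup_uniq.
have yU : y \in U by rewrite mem_undup mem_head.
have c'U h : \sum_(u <- x :: U) c' u * h u =
    w * h x + (\sum_(u <- U) c u * h u - w * q * h y).
  rewrite big_cons {1}/c' eqxx -mulNr -sum_addpoint//; congr (_ + _).
  apply: eq_big_seq => u; rewrite mem_undup /c' => uys.
  by case: eqP => // ux; rewrite ux xNys in uys.
exists c'; split=> [z|f1].
  rewrite c'U inE => /predU1P[->|zys].
    rewrite subrr normr0 oppr0 expR0 mulr1 distrC ger0_norm ?subr_ge0// -/q.
    have -> : \sum_(u <- U) c u * expR (- `|x - u|) = q * f y.
      rewrite -cf ?mem_head// mulr_sumr; apply: eq_big_seq => u.
      rewrite mem_undup => /ys_ge yu.
      rewrite (distrC x) (distrC y) !ger0_norm ?subr_ge0// ?(le_trans xy)//.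
      rewrite mulrCA -expRD; congr (_ * expR _); ring.
    by move: wE; lra.
  rewrite cf//; have yz := ys_ge _ zys.
  rewrite !ger0_norm ?subr_ge0// ?(le_trans xy)//.
  have -> : expR (- (z - x)) = q * expR (- (z - y)).
    by rewrite -expRD; congr expR; ring.
  ring.
have := c'U (fun=> 1); rewrite !mulr1.
rewrite (eq_bigr _ (fun u _ => mulr1 (c' u))).
rewrite (eq_bigr _ (fun u _ => mulr1 (c u))).
move=> ->; rewrite c1//.
rewrite /tanh_half -/q /w !f1; field.
by apply/andP; split; nra.
Qed.

(** Interpolating the indicators of the points gives a right inverse of the
    similarity matrix, which is therefore invertible.  Then the sum of the
    entries of the inverse is the total weight of the solution for [f = 1]. *)
Lemma fmag_line (F : {fset R}) x s : path <=%R x s -> F =i x :: s ->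
  fmag F = line_mag x s.
Proof.
move=> xs Fxs; set e := enum_fset F.
have permF : perm_eq e (undup (x :: s)).
  apply: uniq_perm; [exact: fset_uniq|exact: undup_uniq|].
  by move=> z; rewrite mem_undup -Fxs.
have solve f : exists c : R -> R,
    (forall i : 'I_(#|` F|), \sum_(j < #|` F|)
       expR (- `|e`_i - e`_j|) * c e`_j = f e`_i) /\
    ((forall z, f z = 1) -> \sum_(j < #|` F|) c e`_j = line_mag x s).
  have [c [cf c1]] := line_interpolation f _ _ xs.
  exists c; split=> [i|/c1 <-]; last first.
    by rewrite -(perm_big _ permF)/= (big_nth 0) big_mkord.
  rewrite -cf; last by rewrite -Fxs mem_nth.
  rewrite -(perm_big _ permF)/= (big_nth 0) big_mkord.
  by apply: eq_bigr => j _; rewrite mulrC.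
have Zunit : similarity_mx F \in unitmx.
  have /choice[C CP] : forall k : 'I_(#|` F|), exists c : R -> R,
      forall i : 'I_(#|` F|), \sum_(j < #|` F|)
        expR (- `|e`_i - e`_j|) * c e`_j = (i == k)%:R.
    move=> k; have [c [cf _]] := solve (fun z => (z == e`_k)%:R).
    by exists c => i; rewrite cf nth_uniq// fset_uniq.
  have /mulmx1_unit[] // : similarity_mx F *m (\matrix_(j, k) C k e`_j) = 1%:M.
  apply/matrixP => i k; rewrite !mxE -CP.
  by apply: eq_bigr => j _; rewrite !mxE.
have [c [c1 <-//]] := solve (fun=> 1).
have Zc : similarity_mx F *m (\col_j c e`_j) = const_mx 1.
  apply/matrixP => i k; rewrite !mxE -[RHS](c1 i).
  by apply: eq_bigr => j _; rewrite !mxE.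
have : \col_j c e`_j = invmx (similarity_mx F) *m const_mx 1.
  by rewrite -Zc mulKmx.
move=> /matrixP cE; rewrite /fmag; apply: eq_bigr => i _.
have := cE i 0; rewrite !mxE => ->.
by apply: eq_bigr => j _; rewrite !mxE mulr1.
Qed.

End formula.

(** * Comparison of nearby sets *)

Section comparison.
Context {R : realType}.
Implicit Types (x y d M : R) (s : seq R) (K L : set R).

Lemma line_mag_le x s : path <=%R x s -> line_mag x s <= 1 + (last x s - x) / 2.
Proof.
elim: s x => [|y s ih] x /=; first by rewrite subrr mul0r addr0.
case/andP => xy /ih; have yx : 0 <= y - x by rewrite subr_ge0.
have := tanh_half_le _ yx; lra.
Qed.

Lemma fset_sorted (F : {fset R}) : F != fset0 ->
  exists x s, path <=%R x s /\ F =i x :: s.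
Proof.
case/fset0Pn => z zF.
have := @sort_sorted _ <=%R (@le_total _ _) (enum_fset F).
have : F =i sort <=%R (enum_fset F) by move=> y; rewrite mem_sort.
case: (sort _ _) => [/(_ z)|x s Fxs xs]; first by rewrite zF.
by exists x, s.
Qed.

(** A choice of a nearby point of [L] for each point of the list may reverse
    the order of close points.  The running maximum of the chosen points is
    nondecreasing and stays within [d], because the list is itself
    nondecreasing. *)
Lemma line_follow L d x s x' : 0 <= d -> path <=%R x s ->
  (forall a, a \in s -> exists2 b, L b & `|a - b| <= d) ->
  L x' -> `|x - x'| <= d ->
  exists s', [/\ path <=%R x' s', (forall b, b \in s' -> L b),
    `|last x s - last x' s'| <= d &
    line_mag x s <= line_mag x' s' +
      ((last x s - x) - (last x' s' - x')) / 2 + 2 * d * (last x' s' - x')].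
Proof.
move=> d0; elim: s x x' => [|y s ih] x x' /=.
  by move=> _ _ Lx' xx'; exists [::]; rewrite /= !subrr mulr0; split=> //; lra.
case/andP => xy ys near Lx' xx'.
have [b Lb yb] := near y (mem_head _ _).
pose y' := Num.max x' b.
have Ly' : L y' by rewrite /y' maxEle; case: ifP.
have yy' : `|y - y'| <= d.
  move: xx' yb; rewrite /y' maxEle !ler_distl => /andP[? ?] /andP[? ?].
  by case: (leP x' b) => ?; apply/andP; split; lra.
have [|s' [ys' Ls' lasts' mags']] := ih _ _ ys _ Ly' yy'.
  by move=> a sa; apply: near; rewrite inE sa orbT.
have x'y' : x' <= y' by rewrite le_max lexx.
exists (y' :: s'); split=> //=; first by rewrite x'y'.
  by move=> c; rewrite inE => /predU1P[->|/Ls'].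
have gap : y' - x' <= y - x + 2 * d.
  by move: xx' yy'; rewrite !ler_distl => /andP[? ?] /andP[? ?]; lra.
have yx : 0 <= y - x by rewrite subr_ge0.
have y'x' : 0 <= y' - x' by rewrite subr_ge0.
have := tanh_half_step d _ _ d0 yx y'x' gap.
nra.
Qed.

Lemma fmag0 : fmag (fset0 : {fset R}) = 0.
Proof. by rewrite /fmag big1// => -[i iF]; exfalso; rewrite cardfs0 in iF. Qed.

Lemma fmag_le_bounded (F : {fset R}) M : 0 <= M ->
  (forall x, x \in F -> `|x| <= M) -> fmag F <= 1 + M.
Proof.
move=> M0 FM; have [->|/fset_sorted[x [s [xs Fxs]]]] := eqVneq F fset0.
  by rewrite fmag0; lra.
rewrite (fmag_line _ _ _ xs Fxs) (le_trans (line_mag_le _ _ xs))//.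
have := FM x; have := FM (last x s); rewrite !Fxs mem_head mem_last !ler_norml.
by move=> /(_ isT)/andP[? ?] /(_ isT)/andP[? ?]; lra.
Qed.

Lemma fmag_le_mag L M (F : {fset R}) : 0 <= M ->
  (forall x, L x -> `|x| <= M) -> [set` F] `<=` L -> fmag F <= mag L.
Proof.
move=> M0 LM FL; apply: ub_le_sup; last by exists F.
exists (1 + M) => _ [G GL <-]; apply: fmag_le_bounded => // x xG.
exact/LM/GL.
Qed.

(** In the constant, [1] comes from the two endpoints, whose displacement
    changes half of the diameter by at most [d], and [4 M] comes from the error
    term [2 d] times the diameter, which is at most [2 M] for a subset
    of [L]. *)
Lemma mag_le_near K L M d : 0 <= M -> 0 <= d ->
  (forall x, L x -> `|x| <= M) ->
  (forall a, K a -> exists2 b, L b & `|a - b| <= d) ->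
  mag K <= mag L + (1 + 4 * M) * d.
Proof.
move=> M0 d0 LM KL.
have magL F : [set` F] `<=` L -> fmag F <= mag L.
  exact: (fmag_le_mag L M F M0 LM).
have Cd : 0 <= (1 + 4 * M) * d by rewrite mulr_ge0//; lra.
have set0L (A : set R) : [set` (fset0 : {fset R})] `<=` A.
  by move=> x /=; rewrite in_fset0.
apply: ge_sup.
  by exists (fmag fset0), fset0; first exact: set0L.
move=> _ [F FK <-].
have [->|/fset_sorted[x [s [xs Fxs]]]] := eqVneq F fset0.
  by rewrite -[leLHS]addr0 lerD// magL//; exact: set0L.
have Kxs a : a \in x :: s -> K a by rewrite -Fxs; exact: FK.
have [x' Lx' xx'] := KL x (Kxs _ (mem_head _ _)).
have [|s' [xs' Ls' lasts' mags']] := line_follow L d x s x' d0 xs _ Lx' xx'.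
  by move=> a sa; apply/KL/Kxs; rewrite inE sa orbT.
have Lxs' b : b \in x' :: s' -> L b by rewrite inE => /predU1P[->|/Ls'].
have : fmag [fset z in x' :: s']%fset <= mag L.
  by apply: magL => b /=; rewrite !inE => bs; apply: Lxs'; rewrite inE.
rewrite (fmag_line _ _ _ xs Fxs) (fmag_line _ _ _ xs'); last first.
  by move=> b; rewrite !inE.
have := LM _ (Lxs' _ (mem_last x' s')); have := LM _ Lx'.
move: xx' lasts' mags'; rewrite !ler_distl !ler_norml.
move=> /andP[? ?] /andP[? ?] mags' /andP[? ?] /andP[? ?] magL'.
have : 2 * d * (last x' s' - x') <= 2 * d * (2 * M).
  by rewrite ler_wpM2l ?mulr_ge0//; lra.
lra.
Qed.

Lemma near_point K x d : K !=set0 -> dist_to K x < d ->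
  exists2 a, K a & `|x - a| <= d.
Proof.
move=> K0; rewrite -subr_gt0 => xd.
have [_ [a Ka <-]] := inf_adherent xd (dist_to_has_inf x K0).
by rewrite subrKC => /ltW; exists a.
Qed.

(** A point of [K] need not have a point of [L] at distance at most the excess,
    as [L] may fail to be closed; it has one at any larger distance, and these
    are the values of [d] for which [mag_le_near] is used. *)
Lemma mag_le_excess K L M : compact K -> L !=set0 -> 0 <= M ->
  (forall x, L x -> `|x| <= M) -> K !=set0 ->
  mag K <= mag L + (1 + 4 * M) * hausdorff_excess K L.
Proof.
move=> cK L0 M0 LM [k Kk]; apply/ler_addgt0Pr => e e0.
have C0 : 0 < 1 + 4 * M by lra.
have eC0 : 0 < e / (1 + 4 * M) by exact: divr_gt0.
rewrite -addrA; rewrite -[X in _ * _ + X](divfK (lt0r_neq0 C0)) [_ / _ * _]mulrC.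
rewrite -mulrDr; apply: mag_le_near => //.
  rewrite addr_ge0 ?(ltW eC0)//.
  by rewrite (le_trans _ (dist_to_excess cK L0 Kk))// dist_to_ge0.
move=> a Ka; apply: near_point => //.
by rewrite (le_lt_trans (dist_to_excess cK L0 Ka))// ltrDl.
Qed.

Lemma mag_lipschitz_bounded (A : set R) (K L : Cmp A) M : 0 <= M ->
  (forall x, cmp_set K x -> `|x| <= M) ->
  (forall x, cmp_set L x -> `|x| <= M) ->
  `|mag K - mag L| <= (1 + 4 * M) * mdist K L.
Proof.
move=> M0 KM LM; have C0 : 0 <= 1 + 4 * M by lra.
have le1 : hausdorff_excess K L <= mdist K L.
  by rewrite mdist_CmpE le_max lexx.
have le2 : hausdorff_excess L K <= mdist K L.
  by rewrite mdist_CmpE le_max lexx orbT.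
have cK : compact K by exact: cmp_compact.
have cL : compact L by exact: cmp_compact.
have K0 := cmp_neq0 K; have L0 := cmp_neq0 L.
have := mag_le_excess _ _ _ cK L0 M0 LM K0.
have := mag_le_excess _ _ _ cL K0 M0 KM L0.
rewrite ler_distl; have := ler_wpM2l C0 le1; have := ler_wpM2l C0 le2.
by move=> ? ? ? ?; apply/andP; split; lra.
Qed.

Lemma bounded_set_norm_le (A : set R) : bounded_set A ->
  exists2 M, 0 <= M & forall x, A x -> `|x| <= M.
Proof.
move=> [M [_ AM]]; exists (`|M| + 1); first by rewrite addr_ge0.
by move=> x Ax; apply: AM => //; rewrite ltr_pwDr// ler_norm.
Qed.

End comparison.

Theorem theorem4p6 (R : realType) :
  continuous (fun K : Cmp [set: R] => mag K) /\
  (forall B : set R, bounded_set B ->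
     exists C : R, 0 <= C /\
       forall K L : Cmp B, `|mag K - mag L| <= C * mdist K L).
Proof.
split=> [K|B /bounded_set_norm_le[M M0 BM]].
  have [M M0 KM] := bounded_set_norm_le _ (compact_bounded (@cmp_compact _ _ K)).
  (* A compact set at distance less than 1 from K is bounded by M + 1. *)
  have C0 : 0 < 1 + 4 * (M + 1) by lra.
  apply/(@cvgrPdist_le _ _ _ _ (nbhs_filter K)) => e e0.
  apply/nbhs_ballP; exists (Num.min 1 (e / (1 + 4 * (M + 1)))) => /=.
    by rewrite lt_min ltr01 divr_gt0.
  move=> L; rewrite ballEmdist /= lt_min => /andP[KL1 /ltW KLe].
  rewrite (le_trans (mag_lipschitz_bounded _ K L (M + 1) _ _ _))//.
  - by rewrite addr_ge0.
  - by move=> x /KM xM; rewrite (le_trans xM)// lerDl.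
  - move=> x Lx; have [|a /KM aM xa] := near_point K x 1 (cmp_neq0 K).
      rewrite (le_lt_trans (dist_to_excess _ (cmp_neq0 K) Lx))//.
        exact: cmp_compact.
      by rewrite (le_lt_trans _ KL1)// mdist_CmpE le_max lexx orbT.
    by rewrite -(subrKC a x) (le_trans (ler_normD _ _))// lerD.
  - by rewrite mulrC -ler_pdivlMr.
exists (1 + 4 * M); split=> [|K L]; first lra.
by apply: mag_lipschitz_bounded => // x /cmp_sub /BM.
Qed.
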